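(* Any integral vessel $\mathfrak{IV}$ is gauge similar to a differentiable vessel.
   Context: Subscripts $*$ (as in $\sigma_{1*},\gamma_*,\mathcal E_*$) are part of the name and do not denote adjoints. ''Absolutely continuous'' and ''$L^1_{loc}$'' refer to the operator norm; absolutely continuous means on compact intervals. The variable $t_2$ ranges over an interval $I\subseteq\mathbb R$. An (integral) vessel is a collection $$\mathfrak{IV}=(A_1(t_2),F(t_2,t_2^0),\widetilde B(t_2),C(t_2),D(t_2),\widetilde D(t_2);\sigma_1,\sigma_2,\gamma,\sigma_{1*},\sigma_{2*},\gamma_*;\mathcal H_{t_2},\mathcal E,\mathcal E_*,\widetilde{\mathcal E},\widetilde{\mathcal E}_* )$$ of Hilbert spaces and operator functions of $t_2$ with the following properties. (i) $F$ is an evolution semi-group: $F(t,s):\mathcal H_s\to\mathcal H_t$ is bounded and invertible, $F(r,s)F(s,t)=F(r,t)$, $F(t,t)=I$. (ii) $A_1(t_2):\mathcal H_{t_2}\to\mathcal H_{t_2}$, $\widetilde B(t_2):\widetilde{\mathcal E}\to\mathcal H_{t_2}$, $C(t_2):\mathcal H_{t_2}\to\mathcal E_*$ are bounded; for (almost) all $t$ the functions $s\mapsto F(t,s)\widetilde B(s)\sigma_1(s)$, $s\mapsto F(t,s)\widetilde B(s)\sigma_2(s)$, $s\mapsto C(s)F(s,t)$ are absolutely continuous. (iii) $D(t_2):\mathcal E\to\mathcal E_*$ and $\widetilde D(t_2):\widetilde{\mathcal E}\to\widetilde{\mathcal E}_*$ are absolutely continuous. (iv) $\sigma_2,\gamma\in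 L^1_{loc}$ with values in $\mathcal L(\mathcal E,\widetilde{\mathcal E})$; $\sigma_1(t_2)\in\mathcal L(\mathcal E,\widetilde{\mathcal E})$ is absolutely continuous with invertible values; likewise $\sigma_{2*},\gamma_*\in L^1_{loc}$ with values in $\mathcal L(\mathcal E_*,\widetilde{\mathcal E}_* )$ and $\sigma_{1*}(t_2)\in\mathcal L(\mathcal E_*,\widetilde{\mathcal E}_* )$ is absolutely continuous with invertible values. (v) The vessel conditions hold (those with derivatives for almost all $t_2$): $F(t_2,t_2^0)A_1(t_2^0)=A_1(t_2)F(t_2,t_2^0)$; $\frac{d}{dt_2}\big(F(t_2^0,t_2)\widetilde B\sigma_1\big)+F(t_2^0,t_2)A_1\widetilde B\sigma_2+F(t_2^0,t_2)\widetilde B\gamma=0$; $\sigma_{2*}CA_1F(t_2,t_2^0)-\sigma_{1*}\frac{d}{dt_2}[CF(t_2,t_2^0)]+\gamma_*CF(t_2,t_2^0)=0$; $\sigma_{1*}D=\widetilde D\sigma_1$, $\sigma_{2*}D=\widetilde D\sigma_2$, $\widetilde D\gamma=\sigma_{2*}C\widetilde B\sigma_1-\sigma_{1*}C\widetilde B\sigma_2-\sigma_{1*}\frac{dD}{dt_2}+\gamma_*D$. Two vessels $\mathfrak{IV}$ and $\breve{\mathfrak{IV}}=(\breve A_1,\breve F,\widetilde{\breve B},\breve C,D,\widetilde D;\sigma_1,\sigma_2,\gamma,\sigma_{1*},\sigma_{2*},\gamma_*;\breve{\mathcal H}_{t_2},\mathcal E,\mathcal E_*,\widetilde{\mathcal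 E},\widetilde{\mathcal E}_* )$ (same $D,\widetilde D$ and same external data) are gauge similar if there are bounded operators $T(t_2):\mathcal H_{t_2}\to\breve{\mathcal H}_{t_2}$, defined everywhere and invertible with bounded inverse, such that $\breve A_1(t_2)T(t_2)=T(t_2)A_1(t_2)$, $\breve F(t_2,t_2^0)T(t_2^0)=T(t_2)F(t_2,t_2^0)$, $\widetilde{\breve B}(t_2)=T(t_2)\widetilde B(t_2)$, $\breve C(t_2)T(t_2)=C(t_2)$ for all $t_2,t_2^0$. A vessel is differentiable if $\mathcal H_{t_2}=\mathcal H$ is the same Hilbert space for all $t_2$ and $F(t_2,t_2^0)$ is an absolutely continuous function (of $t_2$, for fixed $t_2^0$) in the operator norm topology of bounded operators on $\mathcal H$. *)

(* Defs.v *)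
From HB Require Import structures.
From mathcomp Require Import all_boot all_order all_algebra sesquilinear.
From mathcomp Require Import complex.
From mathcomp Require Import all_classical all_reals all_analysis.

Set Implicit Arguments.
Unset Strict Implicit.
Unset Printing Implicit Defensive.

Import Order.TTheory GRing.Theory Num.Theory.
Import numFieldNormedType.Exports.

Local Open Scope classical_set_scope.
Local Open Scope ring_scope.
Local Open Scope complex_scope.

Reserved Notation "''L' ( U , V )" (format "''L' ( U ,  V )").
Reserved Notation "A \bo B" (at level 40, left associativity).

(* The library norm of a module over R[i] takes its values in R[i]. *)
Definition rnorm (R : realType) (V : normedModType R[i]) (x : V) : R :=
  complex.Re `|x|.

(* Complex Hilbert spaces; the inner product is linear in its first argument. *)
HB.mixin Record CompleteNormedModule_isHilbert (R : realType) H
    & CompleteNormedModule R[i] H := {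
  hdot : {dot H for @conjc R};
  hdotE : forall x : H, hdot x x = `|x| ^+ 2
}.

#[short(type="hilbertType")]
HB.structure Definition Hilbert (R : realType) :=
  {H of CompleteNormedModule R[i] H & CompleteNormedModule_isHilbert R H}.

Section rnorm_theory.
Context {R : realType} {V : normedModType R[i]}.
Implicit Types x y : V.

Lemma rnormE x : (rnorm x)%:C = `|x|.
Proof.
by rewrite /rnorm RRe_real // normr_real.
Qed.

Lemma rnorm_ge0 x : 0 <= rnorm x.
Proof. by rewrite -ler0c rnormE. Qed.

Lemma rnorm0 : rnorm (0 : V) = 0.
Proof. by rewrite /rnorm normr0. Qed.

Lemma rnorm0_eq0 x : rnorm x = 0 -> x = 0.
Proof. by move=> x0; apply: normr0_eq0; rewrite -rnormE x0. Qed.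

Lemma rnormD x y : rnorm (x + y) <= rnorm x + rnorm y.
Proof. by rewrite -lecR rmorphD /= !rnormE ler_normD. Qed.

Lemma rnormZ (c : R[i]) x : rnorm (c *: x) = complex.Re `|c| * rnorm x.
Proof.
by apply: (@complexI R); rewrite rmorphM /= !rnormE normrZ.
Qed.
End rnorm_theory.

Section bounded_operators.
Context {R : realType} (U V : normedModType R[i]).

Definition bounded_linear : {pred U -> V} := [pred f : U -> V |
  `[< linear f /\ exists M : R, forall x, rnorm (f x) <= M * rnorm x >]].

Record bounded_op := BoundedOp {
  bounded_op_fun :> U -> V;
  bounded_op_subproof : bounded_op_fun \in bounded_linear }.

HB.instance Definition _ := [isSub for bounded_op_fun].
HB.instance Definition _ := [Choice of bounded_op by <:].

Lemma bounded_linear_submod_closed : submod_closed bounded_linear.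
Proof.
split.
  apply/asboolP; split; first by move=> a u v /=; rewrite scaler0 addr0.
  by exists 0 => x; rewrite rnorm0 mul0r.
move=> a f g /asboolP[fL [M fM]] /asboolP[gL [N gN]]; apply/asboolP; split.
  move=> b u v.
  transitivity (a *: f (b *: u + v) + g (b *: u + v)); first by [].
  rewrite fL gL scalerDr addrACA !scalerA [a * b]mulrC -scalerA.
  by rewrite -scalerDr.
exists (complex.Re `|a| * M + N) => x.
have -> : (a *: f + g) x = a *: f x + g x by [].
rewrite (le_trans (rnormD _ _)) // mulrDl lerD // rnormZ -mulrA.
rewrite ler_wpM2l //; case: `|a| (normr_ge0 a) => u v /=.
by rewrite lecE => /andP[].
Qed.

HB.instance Definition _ := GRing.isSubmodClosed.Build _ _ bounded_linear
  bounded_linear_submod_closed.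
HB.instance Definition _ := [SubChoice_isSubLmodule of bounded_op by <:].

Lemma bounded_op_linear (A : bounded_op) : linear A.
Proof. by case: A => f /= /asboolP[]. Qed.

HB.instance Definition _ (A : bounded_op) :=
  GRing.isLinear.Build R[i] U V *:%R A (bounded_op_linear A).

End bounded_operators.

Notation "''L' ( U , V )" := (bounded_op U V) : type_scope.

Section operator_norm.
Context {R : realType} {U V : normedModType R[i]}.
Implicit Types A B : 'L(U, V).

Definition opnorm A : R :=
  sup [set rnorm (A x) | x in [set x : U | rnorm x <= 1]].

Lemma bounded_opD A B x : (A + B) x = A x + B x. Proof. by []. Qed.

Lemma bounded_opZ (c : R[i]) A x : (c *: A) x = c *: A x. Proof. by []. Qed.

Lemma bounded_opP A B : A =1 B -> A = B.
Proof. by move=> AB; apply/val_inj/funext. Qed.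

Lemma bounded_op_bound A :
  exists2 M : R, 0 <= M & forall x, rnorm (A x) <= M * rnorm x.
Proof.
case: A => f fP /=; have /asboolP[_ [M fM]] := fP.
exists `|M| => // x; rewrite (le_trans (fM x)) // ler_wpM2r ?rnorm_ge0 //.
by rewrite real_ler_norm ?num_real.
Qed.

Lemma opnorm_has_sup A :
  has_sup [set rnorm (A x) | x in [set x : U | rnorm x <= 1]].
Proof.
split; first by exists (rnorm (A 0)), 0 => //=; rewrite rnorm0.
have [M M0 AM] := bounded_op_bound A.
exists M => _ [x /= x1 <-]; rewrite (le_trans (AM x)) //.
by rewrite -[leRHS]mulr1 ler_wpM2l.
Qed.

Lemma opnorm_ge0 A : 0 <= opnorm A.
Proof.
apply: (le_trans (rnorm_ge0 (A 0))).
by apply: (sup_upper_bound (opnorm_has_sup A)); exists 0 => //=; rewrite rnorm0.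
Qed.

Lemma ler_opnorm A x : rnorm (A x) <= opnorm A * rnorm x.
Proof.
have [x0|x0] := eqVneq (rnorm x) 0.
  by rewrite (rnorm0_eq0 x0) linear0 !rnorm0 mulr0.
have xp : 0 < rnorm x by rewrite lt_def x0 rnorm_ge0.
have nV : complex.Re `|((rnorm x)^-1)%:C : R[i]| = (rnorm x)^-1.
  by rewrite ger0_norm // lecR invr_ge0 rnorm_ge0.
rewrite -ler_pdivrMr // mulrC -nV -rnormZ -linearZ.
apply: (sup_upper_bound (opnorm_has_sup A)).
by exists ((rnorm x)^-1%:C *: x) => //=; rewrite rnormZ nV mulVf.
Qed.

Lemma opnorm_le A (M : R) : 0 <= M ->
  (forall x, rnorm (A x) <= M * rnorm x) -> opnorm A <= M.
Proof.
move=> M0 AM; apply: sup_le_ub; first by case: (opnorm_has_sup A).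
move=> _ [x /= x1 <-]; rewrite (le_trans (AM x)) //.
by rewrite -[leRHS]mulr1 ler_wpM2l.
Qed.

Let norm A : R[i] := (opnorm A)%:C.

Let ler_normD A B : norm (A + B) <= norm A + norm B.
Proof.
rewrite /norm -rmorphD lecR /=; apply: opnorm_le => [|x].
  by rewrite addr_ge0 ?opnorm_ge0.
by rewrite (le_trans (rnormD _ _)) // mulrDl lerD ?ler_opnorm.
Qed.

Let normr0_eq0 A : norm A = 0 -> A = 0.
Proof.
move=> /(@complexI R) A0; apply: bounded_opP => x; apply: rnorm0_eq0.
by apply/eqP; rewrite eq_le rnorm_ge0 (le_trans (ler_opnorm A x)) // A0 mul0r.
Qed.

Let opnormZ_le (c : R[i]) A : opnorm (c *: A) <= complex.Re `|c| * opnorm A.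
Proof.
have c0 : 0 <= complex.Re `|c|.
  by case: `|c| (normr_ge0 c) => u v; rewrite lecE /= => /andP[].
apply: opnorm_le => [|x]; first by rewrite mulr_ge0 ?opnorm_ge0.
by rewrite bounded_opZ rnormZ -mulrA ler_wpM2l // ler_opnorm.
Qed.

Let normrZ (c : R[i]) A : norm (c *: A) = `|c| * norm A.
Proof.
have cE : (complex.Re `|c|)%:C = `|c| by rewrite RRe_real // normr_real.
rewrite /norm -cE -rmorphM; congr (_ %:C); apply/eqP.
rewrite eq_le opnormZ_le andTb.
have [->|c0] := eqVneq c 0; first by rewrite normr0 mul0r opnorm_ge0.
have Vp : 0 < complex.Re `|c| by rewrite -ltcR cE normr_gt0.
rewrite -ler_pdivlMl //.
have := opnormZ_le c^-1 (c *: A); rewrite scalerA mulVf // scale1r.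
suff -> : complex.Re `|c^-1| = (complex.Re `|c|)^-1 by [].
by apply: (@complexI R); rewrite RRe_real ?normr_real // normfV -[in LHS]cE fmorphV.
Qed.

HB.instance Definition _ := Lmodule_isNormed.Build R[i] 'L(U, V)
  ler_normD normrZ normr0_eq0.

Lemma rnorm_opE A : rnorm A = opnorm A. Proof. by []. Qed.

End operator_norm.

Section composition.
Context {R : realType}.
Implicit Types U V W : normedModType R[i].

Lemma id_op_subproof U : @idfun U \in @bounded_linear R U U.
Proof.
by apply/asboolP; split; [move=> a u v | exists 1 => x; rewrite mul1r].
Qed.

Definition id_op U : 'L(U, U) := BoundedOp (id_op_subproof U).

Lemma comp_op_subproof U V W (A : 'L(V, W)) (B : 'L(U, V)) :
  (A : V -> W) \o B \in @bounded_linear R U W.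
Proof.
have [M M0 AM] := bounded_op_bound A; have [N _ BN] := bounded_op_bound B.
apply/asboolP; split; first by move=> a u v /=; rewrite !linearP.
by exists (M * N) => x /=; rewrite (le_trans (AM _)) // -mulrA ler_wpM2l.
Qed.

Definition comp_op U V W (A : 'L(V, W)) (B : 'L(U, V)) : 'L(U, W) :=
  BoundedOp (comp_op_subproof A B).

Definition op_invertible U V (A : 'L(U, V)) : Prop :=
  exists B : 'L(V, U), comp_op B A = id_op U /\ comp_op A B = id_op V.

End composition.

Notation "A \bo B" := (comp_op A B) : ring_scope.

Section vector_valued_functions.
Context {R : realType} {V : normedModType R[i]}.
Implicit Types (I : set R) (f : R -> V).

(* On each compact [a, b] included in I; the finite families are made of
   pairwise non-overlapping subintervals [x i, y i] of [a, b]. *)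
Definition abs_cont I f : Prop :=
  forall a b : R, `[a, b] `<=` I ->
  forall e : R, 0 < e -> exists2 d : R, 0 < d &
  forall (n : nat) (x y : 'I_n -> R),
    (forall i, a <= x i /\ x i <= y i /\ y i <= b) ->
    trivIset [set: 'I_n] (fun i => `]x i, y i[%classic) ->
    \sum_(i < n) (y i - x i) < d ->
    \sum_(i < n) rnorm (f (y i) - f (x i)) < e.

Definition simple_fun f : Prop :=
  finite_set (range f) /\ forall v, measurable (f @^-1` [set v]).

Definition strongly_measurable I f : Prop :=
  exists2 g : nat -> R -> V, (forall n, simple_fun (g n)) &
  {ae lebesgue_measure, forall t, I t -> g ^~ t @ \oo --> f t}.

(* The integral of a nonnegative function is a supremum over the simple
   functions below it, so it needs no Borel measurability. *)
Definition L1_loc I f : Prop :=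
  strongly_measurable I f /\
  forall a b : R, `[a, b] `<=` I ->
    (\int[lebesgue_measure]_(t in `[a, b]) (rnorm (f t))%:E < +oo)%E.

(* in the norm of V; one-sided at the endpoints of I *)
Definition has_derivative I f (t : R) (l : V) : Prop :=
  (fun s => ((s - t)^-1)%:C *: (f s - f t)) @ within I t^' --> l.

End vector_valued_functions.

(* In names, a final s stands for the subscript star and a final t for the
   tilde; vA is A_1 and vB is B tilde.
   H is indexed by all of R; only its values on I, like those of the operator
   functions, matter.
   Absolute continuity does not imply differentiability almost everywhere for
   operator-valued functions, so the conditions with derivatives also assert
   that the derivative exists in operator norm. *)
Record vessel (R : realType) (I : set R) (E Es Et Ets : hilbertType R)
    (H : R -> hilbertType R) := Vessel {
  vA : forall t, 'L(H t, H t);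
  vF : forall t s, 'L(H s, H t);
  vB : forall t, 'L(Et, H t);
  vC : forall t, 'L(H t, Es);
  vD : R -> 'L(E, Es);
  vDt : R -> 'L(Et, Ets);
  sigma1 : R -> 'L(E, Et);
  sigma2 : R -> 'L(E, Et);
  gamma : R -> 'L(E, Et);
  sigma1s : R -> 'L(Es, Ets);
  sigma2s : R -> 'L(Es, Ets);
  gammas : R -> 'L(Es, Ets);
  vF_invertible : forall t s, I t -> I s -> op_invertible (vF t s);
  vF_comp : forall r s t, I r -> I s -> I t -> vF r s \bo vF s t = vF r t;
  vF_id : forall t, I t -> vF t t = id_op (H t);
  vFBsigma1_ac : {ae lebesgue_measure, forall t, I t ->
    abs_cont I (fun s => vF t s \bo vB s \bo sigma1 s)};
  vFBsigma2_ac : {ae lebesgue_measure, forall t, I t ->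
    abs_cont I (fun s => vF t s \bo vB s \bo sigma2 s)};
  vCF_ac : {ae lebesgue_measure, forall t, I t ->
    abs_cont I (fun s => vC s \bo vF s t)};
  vD_ac : abs_cont I vD;
  vDt_ac : abs_cont I vDt;
  sigma2_L1 : L1_loc I sigma2;
  gamma_L1 : L1_loc I gamma;
  sigma1_ac : abs_cont I sigma1;
  sigma1_invertible : forall t, I t -> op_invertible (sigma1 t);
  sigma2s_L1 : L1_loc I sigma2s;
  gammas_L1 : L1_loc I gammas;
  sigma1s_ac : abs_cont I sigma1s;
  sigma1s_invertible : forall t, I t -> op_invertible (sigma1s t);
  vessel_Lax : forall t t0, I t -> I t0 -> vF t t0 \bo vA t0 = vA t \bo vF t t0;
  vessel_input : forall t0, I t0 -> {ae lebesgue_measure, forall t, I t ->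
    exists2 dFB, has_derivative I (fun s => vF t0 s \bo vB s \bo sigma1 s) t dFB
    & dFB + vF t0 t \bo vA t \bo vB t \bo sigma2 t
        + vF t0 t \bo vB t \bo gamma t = 0};
  vessel_output : forall t0, I t0 -> {ae lebesgue_measure, forall t, I t ->
    exists2 dCF, has_derivative I (fun s => vC s \bo vF s t0) t dCF
    & sigma2s t \bo vC t \bo vA t \bo vF t t0 - sigma1s t \bo dCF
        + gammas t \bo vC t \bo vF t t0 = 0};
  vessel_sigma1 : forall t, I t -> sigma1s t \bo vD t = vDt t \bo sigma1 t;
  vessel_sigma2 : forall t, I t -> sigma2s t \bo vD t = vDt t \bo sigma2 t;
  vessel_linkage : {ae lebesgue_measure, forall t, I t ->
    exists2 dD, has_derivative I vD t dD
    & vDt t \bo gamma t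
      = sigma2s t \bo vC t \bo vB t \bo sigma1 t
        - sigma1s t \bo vC t \bo vB t \bo sigma2 t
        - sigma1s t \bo dD + gammas t \bo vD t}
}.

Definition same_external_data (R : realType) (I : set R)
    (E Es Et Ets : hilbertType R) (H H' : R -> hilbertType R)
    (V : vessel I E Es Et Ets H) (V' : vessel I E Es Et Ets H') : Prop :=
  forall t, I t ->
  [/\ vD V' t = vD V t & vDt V' t = vDt V t] /\
  [/\ sigma1 V' t = sigma1 V t, sigma2 V' t = sigma2 V t
    & gamma V' t = gamma V t] /\
  [/\ sigma1s V' t = sigma1s V t, sigma2s V' t = sigma2s V t
    & gammas V' t = gammas V t].

Definition gauge_similar (R : realType) (I : set R)
    (E Es Et Ets : hilbertType R) (H H' : R -> hilbertType R)
    (V : vessel I E Es Et Ets H) (V' : vessel I E Es Et Ets H') : Prop :=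
  same_external_data V V' /\
  exists T : forall t, 'L(H t, H' t),
  [/\ forall t, I t -> op_invertible (T t),
      forall t, I t -> vA V' t \bo T t = T t \bo vA V t,
      forall t t0, I t -> I t0 -> vF V' t t0 \bo T t0 = T t \bo vF V t t0,
      forall t, I t -> vB V' t = T t \bo vB V t
    & forall t, I t -> vC V' t \bo T t = vC V t].

Definition differentiable_vessel (R : realType) (I : set R)
    (E Es Et Ets H : hilbertType R) (V : vessel I E Es Et Ets (fun=> H)) :=
  forall t0, I t0 -> abs_cont I (fun t => vF V t t0).

(* Main.v *)
Require Import Defs.
From mathcomp Require Import all_boot all_order all_algebra.
From mathcomp Require Import complex.
From mathcomp Require Import all_classical all_reals all_analysis.

(** Transport everything to the fibre over one base point [t0] of [I] by the
    gauge [T t = F(t0, t)].  The evolution becomes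
    [T t \bo F(t, s) \bo T(s)^-1 = id], which is constant, hence absolutely
    continuous; the other operators become
    [A' t = F(t0, t) A(t) F(t, t0)], [B' t = F(t0, t) B(t)] and
    [C' t = C(t) F(t, t0)].  With these operators the differential conditions
    of the new vessel are those of the old one at the base point [t0], and the
    algebraic ones follow from [F(t, t0) F(t0, t) = id].

    The one analytic point is the regularity of [F(t0, s) B(s) sigma_i(s)] and
    of [C(s) F(s, t0)]: the axioms provide it for almost all base points only,
    and [t0] might be exceptional.  If [I] has two points, it has positive
    measure and so contains a good base point [t]
    ([ae_itv_exists]); composition with the fixed bounded operator [F(t0, t)]
    carries absolute continuity from [t] to [t0] ([abs_cont_ae_base]).  If [I]
    has at most one point, every function is absolutely continuous on it. *)

Set Implicit Arguments.
Unset Strict Implicit.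
Unset Printing Implicit Defensive.

Import Order.TTheory GRing.Theory Num.Theory.
Import numFieldNormedType.Exports.

Local Open Scope classical_set_scope.
Local Open Scope ring_scope.
Local Open Scope complex_scope.

Section absolute_continuity.
Context {R : realType} {U V : normedModType R[i]}.
Implicit Types (I : set R) (f : R -> U) (g : R -> V).

Lemma abs_cont_dominated I f g (M : R) : 0 <= M ->
  (forall s t, I s -> I t -> rnorm (g t - g s) <= M * rnorm (f t - f s)) ->
  abs_cont I f -> abs_cont I g.
Proof.
move=> M0 gf fac a b abI e e0.
have M1 : 0 < M + 1 by rewrite ltr_wpDl.
have [d d0 fd] := fac a b abI (e / (M + 1)) (divr_gt0 e0 M1).
exists d => // n x y xy dis sd; have := fd n x y xy dis sd.
rewrite ltr_pdivlMr // mulrC mulr_sumr; apply: le_lt_trans.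
apply: ler_sum => i _; have [ax [xly yb]] := xy i.
have Ix : I (x i) by apply: abI; rewrite /= in_itv /= ax (le_trans xly).
have Iy : I (y i) by apply: abI; rewrite /= in_itv /= yb (le_trans ax).
by rewrite (le_trans (gf _ _ Ix Iy)) // ler_wpM2r ?rnorm_ge0 // lerDl.
Qed.

Lemma abs_cont_constant_on I g :
  (forall s t, I s -> I t -> g s = g t) -> abs_cont I g.
Proof.
move=> gI a b abI e e0; exists 1 => // n x y xy _ _.
rewrite big1 // => i _; have [ax [xly yb]] := xy i.
rewrite (gI (y i) (x i)) ?subrr ?rnorm0 //; apply: abI; rewrite /= in_itv /=.
  by rewrite yb (le_trans ax).
by rewrite ax (le_trans xly).
Qed.

End absolute_continuity.

Section composition_norm.
Context {R : realType} {U V W : normedModType R[i]}.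

Lemma rnorm_comp_opBl (A : 'L(V, W)) (B C : 'L(U, V)) :
  rnorm (A \bo B - A \bo C) <= opnorm A * rnorm (B - C).
Proof.
apply: opnorm_le => [|x]; first by rewrite mulr_ge0 ?opnorm_ge0.
have -> : (A \bo B - A \bo C) x = A ((B - C) x) by exact/esym/linearB.
by rewrite (le_trans (ler_opnorm _ _)) // -mulrA ler_wpM2l ?opnorm_ge0 ?ler_opnorm.
Qed.

Lemma rnorm_comp_opBr (A : 'L(U, V)) (B C : 'L(V, W)) :
  rnorm (B \bo A - C \bo A) <= opnorm A * rnorm (B - C).
Proof.
apply: opnorm_le => [|x]; first by rewrite mulr_ge0 ?opnorm_ge0.
have -> : (B \bo A - C \bo A) x = (B - C) (A x) by [].
rewrite (le_trans (ler_opnorm _ _)) // -mulrA mulrCA ler_wpM2l ?opnorm_ge0 //.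
exact: ler_opnorm.
Qed.

End composition_norm.

Lemma ae_monotone {R : realType} (P Q : R -> Prop) :
  {ae lebesgue_measure, forall t, P t} -> (forall t, P t -> Q t) ->
  {ae lebesgue_measure, forall t, Q t}.
Proof. by move=> + PQ; apply: negligibleS => t; exact: contra_not (PQ t). Qed.

Lemma ae_itv_exists {R : realType} (I : set R) (P : R -> Prop) (a b : R) :
  is_interval I -> I a -> I b -> a < b ->
  {ae lebesgue_measure, forall t, I t -> P t} -> exists2 t, I t & P t.
Proof.
move=> hI Ia Ib ab aeP; apply: contrapT => noP.
have abN : lebesgue_measure.-negligible `[a, b]%classic.
  apply: negligibleS aeP => t /=; rewrite in_itv /= => tab Pt.
  have It : I t by exact: hI Ia Ib _ tab.
  by apply: noP; exists t => //; exact: Pt.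
have ab0 : lebesgue_measure `[a, b]%classic = 0%E :> \bar R.
  by apply: measure_negligible abN; exact: measurable_itv.
move: ab0; rewrite lebesgue_measure_itv /= lte_fin ab -EFinB => -[] /eqP.
by rewrite subr_eq0 gt_eqF.
Qed.

(** The upgrade from almost all base points to the base point [t0]: changing
    the base point amounts to composing with a bounded operator, so each [f t]
    controls [g] up to a constant [M t], and one good [t] is enough. *)
Lemma abs_cont_ae_base {R : realType} (I : set R) (U : R -> normedModType R[i])
    (W : normedModType R[i]) (f : forall t, R -> U t) (g : R -> W)
    (M : R -> R) :
  is_interval I -> (forall t, 0 <= M t) ->
  (forall t r s, I t -> I r -> I s ->
     rnorm (g s - g r) <= M t * rnorm (f t s - f t r)) ->
  {ae lebesgue_measure, forall t, I t -> abs_cont I (f t)} -> abs_cont I g.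
Proof.
move=> hI M0 gf aef.
have [[a [b [Ia [Ib ab]]]]|I1] := pselect (exists a b, I a /\ I b /\ a < b).
  have [t It ft] := ae_itv_exists hI Ia Ib ab aef.
  exact: abs_cont_dominated (M0 t) (fun r s => gf t r s It) ft.
apply: abs_cont_constant_on => s t Is It; congr g.
by apply/eqP; case: ltgtP => // st; case: I1; [exists s, t | exists t, s].
Qed.

Section transport.
Context {R : realType} {I : set R} {E Es Et Ets : hilbertType R}.
Context {H : R -> hilbertType R} (V : vessel I E Es Et Ets H).

Lemma vF_compE r s t x : I r -> I s -> I t ->
  vF V r s (vF V s t x) = vF V r t x.
Proof. by move=> Ir Is It; rewrite -(vF_comp V Ir Is It). Qed.

Lemma vF_idE t x : I t -> vF V t t x = x.
Proof. by move=> It; rewrite vF_id. Qed.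

Lemma vFK s t : I s -> I t -> cancel (vF V s t) (vF V t s).
Proof. by move=> Is It x; rewrite vF_compE // vF_idE. Qed.

Hypothesis hI : is_interval I.

Lemma abs_cont_vFB (sigma : R -> 'L(E, Et)) t0 : I t0 ->
  {ae lebesgue_measure, forall t, I t ->
    abs_cont I (fun s => vF V t s \bo vB V s \bo sigma s)} ->
  abs_cont I (fun s => vF V t0 s \bo vB V s \bo sigma s).
Proof.
move=> It0; apply: (abs_cont_ae_base (M := fun t => opnorm (vF V t0 t)) hI).
  by move=> t; exact: opnorm_ge0.
move=> t r s It Ir Is; apply: le_trans (rnorm_comp_opBl _ _ _).
have base_change u : I u -> vF V t0 u \bo vB V u \bo sigma u
    = vF V t0 t \bo (vF V t u \bo vB V u \bo sigma u).
  by move=> Iu; apply: bounded_opP => x /=; rewrite vF_compE.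
by rewrite !base_change.
Qed.

Lemma abs_cont_vCF t0 : I t0 -> abs_cont I (fun s => vC V s \bo vF V s t0).
Proof.
move=> It0; have := vCF_ac V.
apply: (abs_cont_ae_base (M := fun t => opnorm (vF V t t0)) hI).
  by move=> t; exact: opnorm_ge0.
move=> t r s It Ir Is; apply: le_trans (rnorm_comp_opBr _ _ _).
have base_change u : I u ->
    vC V u \bo vF V u t0 = vC V u \bo vF V u t \bo vF V t t0.
  by move=> Iu; apply: bounded_opP => x /=; rewrite vF_compE.
by rewrite !base_change.
Qed.

(* Conditional membership allows any real number as base point when I is
   empty. *)
Variable t0 : R.
Hypothesis It0 : forall t, I t -> I t0.

Definition transported_vessel : vessel I E Es Et Ets (fun=> H t0).
Proof.
apply: (@Vessel R I E Es Et Ets (fun=> H t0)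
  (fun t => vF V t0 t \bo vA V t \bo vF V t t0)
  (fun _ _ => id_op (H t0))
  (fun t => vF V t0 t \bo vB V t)
  (fun t => vC V t \bo vF V t t0)
  (vD V) (vDt V) (sigma1 V) (sigma2 V) (gamma V)
  (sigma1s V) (sigma2s V) (gammas V)).
- by move=> t s _ _; exists (id_op (H t0)); split; apply: bounded_opP.
- by move=> r s t _ _ _; apply: bounded_opP.
- by [].
- apply: aeW => t It.
  rewrite (_ : (fun s => _) = fun s => vF V t0 s \bo vB V s \bo sigma1 V s).
    exact: abs_cont_vFB (It0 It) (vFBsigma1_ac V).
  by apply/funext => s; apply: bounded_opP.
- apply: aeW => t It.
  rewrite (_ : (fun s => _) = fun s => vF V t0 s \bo vB V s \bo sigma2 V s).
    exact: abs_cont_vFB (It0 It) (vFBsigma2_ac V).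
  by apply/funext => s; apply: bounded_opP.
- apply: aeW => t It.
  rewrite (_ : (fun s => _) = fun s => vC V s \bo vF V s t0).
    exact: abs_cont_vCF (It0 It).
  by apply/funext => s; apply: bounded_opP.
- exact: vD_ac.
- exact: vDt_ac.
- exact: sigma2_L1.
- exact: gamma_L1.
- exact: sigma1_ac.
- exact: sigma1_invertible.
- exact: sigma2s_L1.
- exact: gammas_L1.
- exact: sigma1s_ac.
- exact: sigma1s_invertible.
- (* The Lax condition of V makes F(t0, t) A(t) F(t, t0) independent of t. *)
  move=> t s It Is; apply: bounded_opP => x /=.
  have AE u y : I u -> vF V t0 u (vA V u (vF V u t0 y)) = vA V t0 y.
    move=> Iu; have I0 := It0 Iu.
    have /(congr1 (fun B : 'L(_, _) => B y)) /= <- := vessel_Lax V Iu I0.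
    by rewrite vFK.
  by rewrite !AE.
- move=> s Is; have I0 := It0 Is.
  apply: (ae_monotone (vessel_input V I0)) => t inp It.
  have [dFB dFBP eq0] := inp It; exists dFB.
    rewrite (_ : (fun s => _) = fun s => vF V t0 s \bo vB V s \bo sigma1 V s) //.
    by apply/funext => u; apply: bounded_opP.
  rewrite -[RHS]eq0; apply: bounded_opP => x.
  by rewrite !bounded_opD /= vFK.
- move=> s Is; have I0 := It0 Is.
  apply: (ae_monotone (vessel_output V I0)) => t out It.
  have [dCF dCFP eq0] := out It; exists dCF.
    rewrite (_ : (fun s => _) = fun s => vC V s \bo vF V s t0) //.
    by apply/funext => u; apply: bounded_opP.
  rewrite -[RHS]eq0; congr (_ - _ + _); apply: bounded_opP => x //=.
  by rewrite vFK.
- exact: vessel_sigma1.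
- exact: vessel_sigma2.
- apply: (ae_monotone (vessel_linkage V)) => t link It; have I0 := It0 It.
  have [dD dDP eqD] := link It; exists dD => //; rewrite eqD.
  by congr (_ - _ - _ + _); apply: bounded_opP => x /=; rewrite vFK.
Defined.

Lemma transported_vessel_differentiable :
  differentiable_vessel transported_vessel.
Proof. by move=> s Is; apply: abs_cont_constant_on. Qed.

(** The gauge is [F(t0, t)], whose inverse [F(t, t0)] undoes the conjugation. *)
Lemma gauge_similar_transported : gauge_similar V transported_vessel.
Proof.
split; first by move=> t It; do !split.
exists (vF V t0); split.
- by move=> t It; apply: vF_invertible (It0 It) It.
- move=> t It; have I0 := It0 It; apply: bounded_opP => x /=.
  by rewrite vFK.
- move=> t s It Is; have I0 := It0 It; apply: bounded_opP => x /=.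
  by rewrite vF_compE.
- by [].
- move=> t It; have I0 := It0 It; apply: bounded_opP => x /=.
  by rewrite vFK.
Qed.

End transport.

Theorem proposition3p3 (R : realType) (I : set R) (hI : is_interval I)
    (E Es Et Ets : hilbertType R) (H : R -> hilbertType R)
    (V : vessel I E Es Et Ets H) :
  exists (H0 : hilbertType R) (V0 : vessel I E Es Et Ets (fun=> H0)),
    differentiable_vessel V0 /\ gauge_similar V V0.
Proof.
have [t0 It0] : exists t0, forall t, I t -> I t0.
  have [[t0 It0]|I0] := pselect (exists t, I t); first by exists t0.
  by exists 0 => t It; case: I0; exists t.
exists (H t0), (transported_vessel V hI It0); split.
  exact: transported_vessel_differentiable.
exact: gauge_similar_transported.
Qed.
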